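(* Let $r\le s\le t$ be positive integers such that $K_{r,s,t}$ is decomposable into $5$-cycles. Let $p$ be a positive integer that is a multiple of $5$, with $p\equiv r \pmod 2$ and $\frac{t}{2}\le p\le 3r$. Then $K_{r+2p,\,s+2p,\,t+2p}$ also has a decomposition into $5$-cycles.
   Context: $K_{r,s,t}$ denotes the complete tripartite graph with parts of sizes $r,s,t$. A decomposition of a graph into $5$-cycles is a partition of its edge set into edge sets of cycles of length $5$. *)

(* Defs.v *)
From mathcomp Require Import all_boot.

Set Implicit Arguments.
Unset Strict Implicit.
Unset Printing Implicit Defensive.

Section Graph.

(* A finite simple graph is a symmetric irreflexive adjacency relation e on a
   finType; its edges are the two-element sets of adjacent vertices. *)
Variables (T : finType) (e : rel T).

Definition edges : {set {set T}} :=
  [set [set x.1; x.2] | x : T * T & e x.1 x.2].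

(* [next c x] is the successor of x in c, the last vertex being followed by
   the first. *)
Definition cycle_edges (c : seq T) : {set {set T}} :=
  [set [set x; next c x] | x in c].

(* The bound 2 < k rules out ucycles on one or two vertices, which are not
   cycles of a simple graph. *)
Definition is_cycle_edge_set (k : nat) (B : {set {set T}}) : Prop :=
  exists c : seq T,
    [/\ 2 < k, size c = k, ucycle e c & B = cycle_edges c].

Definition cycle_decomposable (k : nat) : Prop :=
  exists2 P : {set {set {set T}}},
    partition P edges & forall B, B \in P -> is_cycle_edge_set k B.

End Graph.

Definition tripartite_vertex (r s t : nat) : finType :=
  ('I_r + 'I_s + 'I_t)%type.

Definition part (r s t : nat) (v : tripartite_vertex r s t) : nat :=
  match v with
  | inl (inl _) => 0
  | inl (inr _) => 1
  | inr _ => 2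
  end.

Definition complete_tripartite (r s t : nat) : rel (tripartite_vertex r s t) :=
  fun u v => part u != part v.

Arguments complete_tripartite r s t u v : clear implicits.

(* Main.v *)
Require Import Defs.
From mathcomp Require Import all_boot.
From mathcomp Require Import zify.

Set Implicit Arguments.
Unset Strict Implicit.
Unset Printing Implicit Defensive.

(** Write n = 2p = 10q and call the vertices added to K_(r,s,t) new, the others
    old.  The edges of the large graph with two old ends form K_(r,s,t), which is
    decomposable; what has to be decomposed is the graph H of all edges with at
    least one new end.

    H splits into q^2 cells.  In each part the new vertices are cut into q rows
    of 10, and the old vertices are dealt out to the same q rows.  The cell
    (i, j) takes row i of the first part, row j of the second and row i + j
    modulo q of the third.  Because the Cayley table of Z/q is a Latin square,
    two rows of different parts lie together in exactly one cell
    (row_at_inj, row_at_surj), so every edge of H lies in exactly one cell.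

    An old part of size R gives one single vertex to each row and arranges the
    other R - q vertices in pairs, at most five pairs per row.  This is where
    the hypotheses enter: q <= r follows from p <= 3r, the room for the pairs
    from t <= 2p, and R - q is even because p and r have the same parity, which
    is also that of s and t since all degrees of a decomposable graph are even
    (even_degree).

    It remains to decompose a cell: three parts, each with 10 new vertices, one
    single old vertex and any number of the five possible pairs, the edges
    being those with a new end.  Without pairs the cell has 360 edges, and it
    is the union of 12 fixed 5-cycles and of 15 groups of four 5-cycles, one
    group for each possible pair.  The group of a pair is a trade: its 20 edges
    together with the 40 edges that join the pair to the new vertices of the
    other two parts can be redecomposed into 12 5-cycles.  Since the groups are
    edge-disjoint, each pair can be added independently of the others
    (cell_uniq, cell_arcs).

    Such a trade exists for the following reason.  Let x, y be a pair in part 0.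
    A path of three edges between new vertices u, v of the parts 1 and 2 is
    closed to a 5-cycle by x or by y, and an edge uv between two such vertices
    is closed to a 5-cycle u v y w x by a further new vertex w of these parts.
    If the 20 edges of the group split into four such paths and eight such
    edges, whose ends are 12 vertices, each of them end of two pieces and joined
    to x in one of them and to y in the other, then the eight remaining
    vertices serve as the w, and every edge from x or y to a new vertex is
    covered exactly once.  The explicit solution comes from a search among
    families of groups that are invariant under the cyclic permutation of the
    three parts and under a group of order 5; the fixed cycles are invariant
    under the former.  So one trade and four of the fixed 5-cycles determine
    the whole cell. *)

(** * Unions and copies of decompositions *)

Lemma edgesP (T : finType) (e : rel T) (E : {set T}) :
  reflect (exists u v, e u v /\ E = [set u; v]) (E \in edges e).
Proof.
apply: (iffP imsetP) => [[[u v]]|[u [v [euv ->]]]].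
  by rewrite inE => euv ->; exists u, v.
by exists (u, v); rewrite ?inE.
Qed.

Lemma eq_set2 (T : finType) (u v x y : T) :
  [set u; v] = [set x; y] -> (u = x /\ v = y) \/ (u = y /\ v = x).
Proof.
move=> eqE.
have := set21 u v; have := set22 u v; have := set21 x y; have := set22 x y.
rewrite {1 2}eqE -{1 2}eqE !inE.
by move=> /orP[] /eqP-> /orP[] /eqP <- /orP[] /eqP ? /orP[] /eqP ?; subst; auto.
Qed.

(** Symmetry is needed because an edge is an unordered pair: without it
    [e1 u v] and [e2 v u] could describe the same edge. *)
Lemma decomposable_union (T : finType) (e1 e2 e : rel T) k :
  symmetric e2 -> (forall u v, e1 u v -> ~~ e2 u v) ->
  (forall u v, e u v = e1 u v || e2 u v) ->
  cycle_decomposable e1 k -> cycle_decomposable e2 k ->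
  cycle_decomposable e k.
Proof.
move=> sym2 dis12 eE [P1 partP1 cycP1] [P2 partP2 cycP2].
have dis: [disjoint edges e1 & edges e2].
  apply/pred0P => E /=; apply/negP => /andP[/edgesP[u [v [e1uv ->]]]].
  move=> /edgesP[x [y [e2xy /eq_set2]]].
  by case=> -[? ?]; subst; have := dis12 _ _ e1uv; rewrite ?e2xy // sym2 e2xy.
case/and3P: partP1 => /eqP cov1 triv1 n01.
case/and3P: partP2 => /eqP cov2 triv2 n02.
exists (P1 :|: P2).
  apply/and3P; split.
  - rewrite /cover bigcup_setU -/(cover P1) -/(cover P2) cov1 cov2.
    apply/eqP/setP => E; rewrite inE; apply/orP/edgesP.
      by case=> /edgesP[u [v [euv ->]]]; exists u, v; rewrite eE euv ?orbT.
    by case=> u [v []]; rewrite eE => /orP[] euv ->; [left|right];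
      apply/edgesP; exists u, v.
  - by apply: trivIsetU => //; rewrite cov1 cov2.
  - by rewrite inE negb_or n01.
have widen e' B : subrel e' e -> is_cycle_edge_set e' k B ->
    is_cycle_edge_set e k B.
  move=> sub_e [c [k2 szc /andP[cyc_c Uc] ->]]; exists c; split=> //.
  by rewrite /ucycle (sub_cycle sub_e).
by move=> B /setUP[/cycP1|/cycP2]; apply: widen => u v; rewrite eE => ->;
  rewrite ?orbT.
Qed.

Lemma decomposable_empty (T : finType) (e : rel T) k :
  (forall u v, ~~ e u v) -> cycle_decomposable e k.
Proof.
move=> e0; exists set0 => [|B]; last by rewrite inE.
apply/and3P; split; rewrite ?inE //.
  rewrite /cover big_set0 eq_sym -subset0; apply/subsetP=> E.
  by case/edgesP=> u [v [euv _]]; case/negP: (e0 u v).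
by apply/trivIsetP => A B; rewrite inE.
Qed.

Lemma eq_decomposable (T : finType) (e1 e2 : rel T) k :
  e1 =2 e2 -> cycle_decomposable e1 k -> cycle_decomposable e2 k.
Proof.
move=> e12 dec1.
by apply: (@decomposable_union _ e1 (fun _ _ => false)) => // [u v|];
  [rewrite orbF e12 | apply: decomposable_empty].
Qed.

Lemma decomposable_bigunion (T I : finType) (e_ : I -> rel T) (e : rel T) k :
  (forall i, symmetric (e_ i)) -> (forall i, cycle_decomposable (e_ i) k) ->
  (forall i j u v, e_ i u v -> e_ j u v -> i = j) ->
  (forall u v, e u v = [exists i, e_ i u v]) -> cycle_decomposable e k.
Proof.
move=> sym_e dec_e dis_e eE.
have dec_r r : uniq r ->
    cycle_decomposable (fun u v => has (fun i => e_ i u v) r) k.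
  elim: r => [_|i r IHr /= /andP[nri Ur]]; first exact: decomposable_empty.
  apply: (decomposable_union _ _ _ (dec_e i) (IHr Ur)) => //.
    by move=> u v; apply: eq_has => j; apply: sym_e.
  move=> u v eiuv; apply/hasPn => j rj; apply: contra nri => ejuv.
  by rewrite (dis_e _ _ _ _ eiuv ejuv).
apply: eq_decomposable (dec_r _ (enum_uniq I)) => u v; rewrite eE.
by apply/hasP/existsP=> [[i _ ?]|[i ?]]; exists i; rewrite ?mem_enum.
Qed.

(** The second graph may have further vertices, all of them isolated. *)
Lemma decomposable_inj (T T' : finType) (e : rel T) (e' : rel T')
    (h : T -> T') k :
  injective h -> (forall x y, e' (h x) (h y) = e x y) ->
  (forall u v, e' u v -> (u \in codom h) && (v \in codom h)) ->
  cycle_decomposable e k -> cycle_decomposable e' k.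
Proof.
move=> inj_h eE e'h [P partP cycP].
pose hE (E : {set T}) := h @: E; pose hB (B : {set {set T}}) := hE @: B.
have inj_hE : injective hE by apply: imset_inj.
have h2 x y : hE [set x; y] = [set h x; h y] by rewrite /hE imsetU !imset_set1.
exists (hB @: P).
  have ->: edges e' = hE @: edges e; last by rewrite imset_partition.
  apply/setP => E.
  apply/edgesP/imsetP => [[u [v [e'uv ->]]]|[_ /edgesP[x [y [exy ->]] ->]]].
    case/andP: (e'h u v e'uv) => /codomP[x ux] /codomP[y vy]; subst.
    by exists [set x; y]; [apply/edgesP; exists x, y; rewrite -eE|].
  by exists (h x), (h y); rewrite eE -h2.
move=> _ /imsetP[B /cycP[c [k2 szc /andP[cyc_c Uc] ->]] ->].
exists (map h c); split; rewrite ?size_map //.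
  rewrite /ucycle map_inj_uniq // Uc andbT.
  by rewrite cycle_map (eq_cycle (e' := e)).
apply/setP=> E; apply/imsetP/imsetP.
  case=> _ /imsetP[x cx ->] ->; exists (h x); first by rewrite map_f.
  by rewrite h2 next_map.
case=> _ /mapP[x cx ->] ->; rewrite next_map //.
exists [set x; next c x]; first by apply/imsetP; exists x.
by rewrite h2.
Qed.

(** * Decompositions given by lists of cycles *)

(** Both orientations of every edge of the cycle: a list of cycles is then a
    decomposition of [e] exactly when its arcs list the pairs related by [e]
    without repetition.  Zipping with the rotation, rather than using [next],
    makes the operation commute with every map, injective or not. *)
Definition arcs (D : eqType) (c : seq D) : seq (D * D) :=
  zip c (rot 1 c) ++ zip (rot 1 c) c.

Definition all_arcs (D : eqType) (cs : seq (seq D)) : seq (D * D) :=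
  flatten (map (@arcs D) cs).

Lemma mem_zip_rot1 (D : eqType) (c : seq D) u v : uniq c ->
  ((u, v) \in zip c (rot 1 c)) = (u \in c) && (v == next c u).
Proof.
case: c => [|x p] // Uc.
have szr : size (x :: p) = size (rot 1 (x :: p)) by rewrite size_rot.
have nth_rot i : nth x (rot 1 (x :: p)) i = nth x p i.
  rewrite rot1_cons nth_rcons; case: ltnP => // le_pi.
  by rewrite nth_default //; case: eqP.
apply/(nthP (x, x))/andP => [[i]|[cu /eqP->]].
  rewrite size_zip -szr minnn nth_zip // nth_rot => lti [<- <-].
  by rewrite mem_nth // next_nth mem_nth // index_uniq.
exists (index u (x :: p)); first by rewrite size_zip -szr minnn index_mem.
by rewrite nth_zip // nth_rot nth_index // next_nth cu.
Qed.

Lemma mem_arcs (D : eqType) (c : seq D) u v : uniq c ->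
  ((u, v) \in arcs c) =
    ((u \in c) && (v == next c u)) || ((v \in c) && (u == next c v)).
Proof.
move=> Uc; rewrite mem_cat mem_zip_rot1 //; congr (_ || _).
rewrite -mem_zip_rot1 //; elim: c (rot 1 c) {Uc} => [|x s IHs] [|y t] //=.
by rewrite !inE IHs !xpair_eqE andbC.
Qed.

Lemma arcs_sym (D : eqType) (c : seq D) u v : uniq c ->
  ((u, v) \in arcs c) = ((v, u) \in arcs c).
Proof. by move=> Uc; rewrite !mem_arcs // orbC. Qed.

Lemma decomposable_cycle (T : finType) (c : seq T) k :
  2 < k -> uniq c -> size c = k ->
  cycle_decomposable (fun u v => (u, v) \in arcs c) k.
Proof.
move=> k2 Uc szc; exists [set cycle_edges c]; last first.
  move=> B /set1P->; exists c; split=> //; apply/andP; split=> //.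
  by apply: cycle_from_next => // x cx; rewrite mem_arcs // cx eqxx.
apply/and3P; split; last first.
- rewrite inE eq_sym; apply/set0Pn.
  case: c szc {Uc} => [|x p] szc; first by rewrite -szc in k2.
  exists [set x; next (x :: p) x]; apply/imsetP.
  by exists x; rewrite ?inE ?eqxx.
- exact: trivIset1.
rewrite /cover big_set1; apply/eqP/setP => E; apply/imsetP/edgesP.
  by case=> x cx ->; exists x, (next c x); rewrite mem_arcs // cx eqxx.
case=> u [v []]; rewrite mem_arcs // => /orP[] /andP[cu /eqP->] ->.
  by exists u.
by exists v => //; rewrite setUC.
Qed.

Lemma decomposable_seq (T : finType) (cs : seq (seq T)) k :
  2 < k -> all (fun c => uniq c && (size c == k)) cs -> uniq (all_arcs cs) ->
  cycle_decomposable (fun u v => (u, v) \in all_arcs cs) k.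
Proof.
move=> k2; elim: cs => [_ _|c cs IHcs /= /andP[/andP[Uc /eqP szc] all_cs]].
  exact: decomposable_empty.
rewrite /all_arcs /= cat_uniq -/(all_arcs cs) => /and3P[_ disc Ucs].
apply: decomposable_union (decomposable_cycle k2 Uc szc) (IHcs all_cs Ucs).
- move=> u v; apply/flatten_mapP/flatten_mapP => -[d csd uvd];
    exists d => //; rewrite arcs_sym //;
    by have /andP[] := allP all_cs d csd.
- by move=> u v cuv; apply: contra disc => csuv; apply/hasP; exists (u, v).
- by move=> u v; rewrite mem_cat.
Qed.

Lemma map_arcs (D D' : eqType) (h : D -> D') c :
  arcs (map h c) = map (fun a => (h a.1, h a.2)) (arcs c).
Proof.
have map_zip s t : zip (map h s) (map h t) =
    map (fun a => (h a.1, h a.2)) (zip s t).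
  by elim: s t => [|x s IHs] [|y t] //=; rewrite IHs.
by rewrite /arcs -map_rot !map_zip map_cat.
Qed.

Lemma map_all_arcs (D D' : eqType) (h : D -> D') cs :
  all_arcs (map (map h) cs) = map (fun a => (h a.1, h a.2)) (all_arcs cs).
Proof.
rewrite /all_arcs map_flatten -!map_comp; congr flatten.
by apply: eq_map => c; apply: map_arcs.
Qed.

Lemma mem_all_arcs (D : eqType) (cs : seq (seq D)) c x :
  c \in cs -> uniq c -> x \in c -> (x, next c x) \in all_arcs cs.
Proof.
move=> csc Uc cx; apply/flatten_mapP; exists c => //.
by rewrite mem_arcs // cx eqxx.
Qed.

(** Lets the cycles be written over any convenient set of labels [D]: [g] labels
    the vertices in [A], and every label in use belongs to exactly one of them.
    The cycles are pulled back along the inverse of [g]. *)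
Lemma decomposable_preim (D : eqType) (cs : seq (seq D)) (T : finType)
    (A : pred T) (g : T -> D) (e : rel T) k :
  2 < k -> all (fun c => uniq c && (size c == k)) cs -> uniq (all_arcs cs) ->
  {in A &, injective g} ->
  (forall x y, (x, y) \in all_arcs cs -> exists2 u, u \in A & g u = x) ->
  (forall u v, e u v = [&& u \in A, v \in A & (g u, g v) \in all_arcs cs]) ->
  cycle_decomposable e k.
Proof.
move=> k2 all_cs Ucs inj_g surj_g eE.
case: (pickP A) => [u0 Au0|A0]; last first.
  by apply: decomposable_empty => u v; rewrite eE unfold_in A0.
pose h x := odflt u0 [pick u | (u \in A) && (g u == x)].
have gK u : u \in A -> h (g u) = u.
  rewrite /h; case: pickP => [v /andP[Av /eqP gvu]|/(_ u) no_u] Au.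
    exact: inj_g.
  by rewrite Au eqxx in no_u.
have hP x y : (x, y) \in all_arcs cs -> (h x \in A) /\ g (h x) = x.
  by case/surj_g=> u Au <-; rewrite gK.
have arc_sym x y : (x, y) \in all_arcs cs -> (y, x) \in all_arcs cs.
  case/flatten_mapP=> c csc; have /andP[Uc _] := allP all_cs c csc.
  by rewrite arcs_sym // => cyx; apply/flatten_mapP; exists c.
have inj_h x y x' y' : (x, y) \in all_arcs cs -> (x', y') \in all_arcs cs ->
  h x = h x' -> x = x'.
  by move=> /hP[_ {2}<-] /hP[_ {2}<-] ->.
apply: eq_decomposable (decomposable_seq (cs := map (map h) cs) k2 _ _).
- move=> u v; rewrite eE map_all_arcs; apply/mapP/and3P.
    case=> -[x y] xy [-> ->]; have [Ax gx] := hP _ _ xy.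
    by have [Ay gy] := hP _ _ (arc_sym _ _ xy); rewrite Ax Ay gx gy.
  by case=> Au Av uv; exists (g u, g v); rewrite //= !gK.
- apply/allP=> _ /mapP[c csc ->]; rewrite size_map.
  have /andP[Uc ->] := allP all_cs c csc; rewrite andbT map_inj_in_uniq //.
  by move=> x y cx cy; apply: inj_h; apply: (mem_all_arcs csc).
rewrite map_all_arcs map_inj_in_uniq // => -[x y] [x' y'] xy xy' [hx hy].
rewrite (inj_h _ _ _ _ xy xy' hx).
by rewrite (inj_h _ _ _ _ (arc_sym _ _ xy) (arc_sym _ _ xy') hy).
Qed.

(** * Parity of degrees *)

Lemma next_next_neq (T : eqType) (c : seq T) x :
  2 < size c -> uniq c -> x \in c -> next c (next c x) != x.
Proof.
move=> szc Uc cx; have [i p def_c] := rot_to cx.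
move: szc (Uc); rewrite -(rot_uniq i) -(size_rot i) -!(next_rot i Uc) def_c.
case: p {def_c} => [|y [|z p]] //= _; rewrite !inE !negb_or !eqxx.
by case/and3P=> /and3P[xy xz _] _ _; rewrite [y == x]eq_sym (negPf xy) eq_sym.
Qed.

(** A cycle of the decomposition contains two of the edges at [u] or none. *)
Lemma even_degree (T : finType) (e : rel T) k u :
  symmetric e -> irreflexive e -> cycle_decomposable e k ->
  ~~ odd #|[set v | e u v]|.
Proof.
move=> sym_e irr_e [P partP cycP].
have ->: #|[set v | e u v]| = \sum_(E in edges e) (u \in E).
  rewrite -[RHS]big_mkcondr /= -sum1_card.
  transitivity (\sum_(E in [set [set u; v] | v in [set v | e u v]]) 1).
    rewrite big_imset //= => v w; rewrite !inE => euv euw /eq_set2.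
    by case=> -[] // uw _; rewrite -uw irr_e in euw.
  apply: eq_bigl => E; apply/imsetP/andP => [[v]|[/edgesP[x [y [exy ->]]]]].
    rewrite inE => euv ->; rewrite set21; split=> //.
    by apply/edgesP; exists u, v.
  rewrite !inE => /orP[] /eqP ux; subst; first by exists y; rewrite ?inE.
  by exists x; rewrite ?inE 1?sym_e // setUC.
rewrite (set_partition_big _ partP) /=.
apply: (big_ind (fun n => ~~ odd n)) => // [m n|B /cycP].
  by rewrite oddD => /negPf-> /negPf->.
case=> c [k2 szc /andP[_ Uc] ->]; rewrite -szc in k2.
have nn := next_next_neq k2 Uc.
rewrite big_imset /= => [|x y cx cy /eq_set2]; last first.
  by case=> -[] // xy yx; have := nn y cy; rewrite -xy yx eqxx.
have n1 x : x \in c -> next c x != x.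
  by move=> cx; apply: contraNneq (nn x cx) => nx; rewrite !nx.
(* A vertex of a cycle lies on the edge that it starts and on the one that it
   ends. *)
under eq_bigr => x cx.
  have -> : (u \in [set x; next c x]) = (u == x) + (u == next c x) :> nat.
    rewrite !inE; case: (u =P x) => [->|_] //.
    by rewrite eq_sym (negPf (n1 x cx)).
  over.
rewrite big_split /= [X in _ + X](reindex_onto (prev c) (next c)) /=; last first.
  by move=> x _; rewrite prev_next.
rewrite [X in _ + X](eq_big (fun x => x \in c) (fun x => (u == x) : nat)).
- by rewrite addnn odd_double.
- by move=> x; rewrite mem_prev next_prev // eqxx andbT.
by move=> x _; rewrite next_prev.
Qed.

(** * The decomposition of a cell *)

Lemma all_arcs_cat (D : eqType) (cs ds : seq (seq D)) :
  all_arcs (cs ++ ds) = all_arcs cs ++ all_arcs ds.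
Proof. by rewrite /all_arcs map_cat flatten_cat. Qed.

Lemma mem_all_arcs_flatten (I : Type) (D : eqType) (F : I -> seq (seq D)) r a :
  (a \in all_arcs (flatten (map F r))) = has (fun i => a \in all_arcs (F i)) r.
Proof. by elim: r => //= i r IHr; rewrite all_arcs_cat mem_cat IHr. Qed.

Lemma count_all_arcs_flatten (I D : eqType) (F G : I -> seq (seq D)) r a :
  (forall i, i \in r ->
     count_mem a (all_arcs (F i)) <= count_mem a (all_arcs (G i))) ->
  count_mem a (all_arcs (flatten (map F r))) <=
    count_mem a (all_arcs (flatten (map G r))).
Proof.
elim: r => //= i r IHr leFG; rewrite !all_arcs_cat !count_cat leq_add //.
  by apply: leFG; rewrite inE eqxx.
by apply: IHr => j rj; apply: leFG; rewrite inE rj orbT.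
Qed.

(** A vertex of a cell is a pair (part, position): the positions 0 to 9 are the
    new vertices, 10 is the single old vertex, and 11 + 2l, 12 + 2l is the l-th
    pair of old vertices.  [turn c l] permutes the parts cyclically by [c] and
    acts on the ten new positions as translation by [l] on two copies of Z/5,
    while it carries the pair 0 to the pair [l]. *)
Definition turn (c l : nat) (v : nat * nat) : nat * nat :=
  ((v.1 + c) %% 3,
   if v.2 < 10 then v.2 %/ 5 * 5 + (v.2 + l) %% 5
   else if v.2 == 10 then 10 else v.2 + 2 * l).

Definition turn_cycles (s : nat * nat) (cs : seq (seq (nat * nat))) :=
  map (map (turn s.1 s.2)) cs.

(** The possible places (part, number) of a pair. *)
Definition slots := [seq (c, l) | c <- iota 0 3, l <- iota 0 5].

Arguments slots : simpl never.

Definition rigid_cycles : seq (seq (nat * nat)) :=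
  [:: [:: (0, 5); (1, 8); (2, 6); (1, 7); (2, 10)];
      [:: (0, 6); (1, 5); (2, 9); (1, 6); (2, 10)];
      [:: (0, 5); (1, 10); (2, 8); (1, 9); (2, 7)];
      [:: (0, 9); (1, 10); (2, 7); (1, 8); (2, 10)]].

(** The trade of the pair 0 of part 0, before and after the pair is added.  In
    [trade_on] the first four cycles close a path of three edges by a vertex of
    the pair; each of the last eight closes a single edge, its second and third
    vertices, by both vertices of the pair and a vertex that is no end of any
    of the twelve pieces. *)
Definition trade_off : seq (seq (nat * nat)) :=
  [:: [:: (0, 5); (1, 2); (2, 4); (1, 1); (2, 8)];
      [:: (0, 5); (1, 4); (2, 0); (1, 0); (2, 4)];
      [:: (0, 3); (1, 7); (2, 7); (1, 2); (2, 5)];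
      [:: (0, 3); (1, 10); (2, 1); (1, 6); (2, 7)]].

Definition trade_on : seq (seq (nat * nat)) :=
  [:: [:: (0, 11); (1, 4); (0, 5); (1, 2); (2, 4)];
      [:: (0, 12); (1, 0); (2, 4); (0, 5); (2, 8)];
      [:: (0, 11); (1, 7); (0, 3); (1, 10); (2, 1)];
      [:: (0, 12); (1, 7); (2, 7); (0, 3); (2, 5)];
      [:: (0, 11); (1, 1); (2, 4); (0, 12); (1, 3)];
      [:: (0, 12); (1, 1); (2, 8); (0, 11); (1, 5)];
      [:: (0, 12); (1, 4); (2, 0); (0, 11); (1, 8)];
      [:: (0, 11); (1, 0); (2, 0); (0, 12); (1, 9)];
      [:: (0, 11); (1, 2); (2, 7); (0, 12); (2, 2)];
      [:: (0, 12); (1, 2); (2, 5); (0, 11); (2, 3)];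
      [:: (0, 11); (1, 6); (2, 1); (0, 12); (2, 6)];
      [:: (0, 12); (1, 6); (2, 7); (0, 11); (2, 9)]].

Definition rigid_part :=
  flatten [seq turn_cycles (c, 0) rigid_cycles | c <- iota 0 3].

(** [S] tells which pairs are present. *)
Definition cell_cycles (S : pred (nat * nat)) : seq (seq (nat * nat)) :=
  rigid_part ++
  flatten [seq turn_cycles s (if S s then trade_on else trade_off) | s <- slots].

Definition present (S : pred (nat * nat)) (v : nat * nat) : bool :=
  (v.1 < 3) && ((v.2 < 11) || (v.2 < 21) && S (v.1, (v.2 - 11)./2)).

Definition cell_rel (S : pred (nat * nat)) : rel (nat * nat) :=
  fun u v =>
    [&& present S u, present S v, u.1 != v.1 & (u.2 < 10) || (v.2 < 10)].

Definition in_slot (s v : nat * nat) : bool :=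
  [&& v.2 < 21, v.1 == s.1, 10 < v.2 & (v.2 - 11)./2 == s.2].

(** The edges gained when the pair in slot [s] is added. *)
Definition star_rel (s : nat * nat) : rel (nat * nat) :=
  fun u v =>
    [&& u.1 < 3, v.1 < 3, u.1 != v.1 &
        in_slot s u && (v.2 < 10) || in_slot s v && (u.2 < 10)].

Definition box := [seq (c, x) | c <- iota 0 3, x <- iota 0 21].

Arguments box : simpl never.

Definition rel_arcs (R : rel (nat * nat)) : seq ((nat * nat) * (nat * nat)) :=
  [seq a <- [seq (u, v) | u <- box, v <- box] | R a.1 a.2].

Definition arc_le (a b : (nat * nat) * (nat * nat)) : bool :=
  let le_lex := foldr (fun (p : nat * nat) r =>
     (p.1 < p.2) || (p.1 == p.2) && r) true in
  le_lex [:: (a.1.1, b.1.1); (a.1.2, b.1.2); (a.2.1, b.2.1); (a.2.2, b.2.2)].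

(** A test of [perm_eq] that is fast enough for the tables below.  The relation
    may be arbitrary, since sorting always permutes the list. *)
Lemma sort_perm_eq (T : eqType) (r : rel T) (s t : seq T) :
  sort r s == sort r t -> perm_eq s t.
Proof. by move=> /eqP eq_st; rewrite -(perm_sort r s) eq_st perm_sort. Qed.

Lemma cell_perm_empty :
  perm_eq (all_arcs (cell_cycles pred0)) (rel_arcs (cell_rel pred0)).
Proof. by apply: (@sort_perm_eq _ arc_le); vm_compute. Qed.

Lemma cell_perm_full :
  perm_eq (all_arcs (cell_cycles predT)) (rel_arcs (cell_rel predT)).
Proof. by apply: (@sort_perm_eq _ arc_le); vm_compute. Qed.

Lemma trade_perm s : s \in slots ->
  perm_eq (all_arcs (turn_cycles s trade_on))
          (all_arcs (turn_cycles s trade_off) ++ rel_arcs (star_rel s)).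
Proof.
move=> slot_s; apply: (@sort_perm_eq _ arc_le); move: s slot_s; apply/allP.
by vm_compute.
Qed.

Lemma cell_cycles_ok S : all (fun c => uniq c && (size c == 5)) (cell_cycles S).
Proof.
have ok s : s \in slots -> forall b : bool,
    all (fun c => uniq c && (size c == 5))
        (turn_cycles s (if b then trade_on else trade_off)).
  by move=> slot_s b; move: s slot_s; apply/allP; case: b; vm_compute.
rewrite all_cat; apply/andP; split; first by vm_compute.
by apply/allP => x /flatten_mapP[s /ok ok_s]; apply: (allP (ok_s (S s))).
Qed.

Lemma mem_rel_arcs (R : rel (nat * nat)) u v :
  (R u v -> [&& u.1 < 3, u.2 < 21, v.1 < 3 & v.2 < 21]) ->
  ((u, v) \in rel_arcs R) = R u v.
Proof.
have mem_box w : w.1 < 3 -> w.2 < 21 -> w \in box.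
  by case: w => c x c3 x21; apply/allpairsP; exists (c, x); rewrite !mem_iota.
move=> boxR; rewrite mem_filter; change (R (u, v).1 (u, v).2) with (R u v).
case: (R u v) boxR => // /(_ isT).
case/and4P=> u1 u2 v1 v2; apply/allpairsP; exists (u, v).
by split; rewrite ?mem_box.
Qed.

Lemma uniq_rel_arcs R : uniq (rel_arcs R).
Proof.
rewrite /rel_arcs; apply: filter_uniq.
apply: allpairs_uniq; [by vm_compute | by vm_compute |].
by move=> [a b] [c d] _ _ [-> ->].
Qed.

(* These tables stay folded from here on: a proof that reduced them would list
   all the arcs. *)
Opaque rel_arcs slots rigid_part trade_on trade_off.

Lemma cell_arcs_empty u v :
  ((u, v) \in all_arcs (cell_cycles pred0)) = cell_rel pred0 u v.
Proof.
apply: etrans (perm_mem cell_perm_empty (u, v)) _; apply: mem_rel_arcs.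
by rewrite /cell_rel /present /= !andbF; lia.
Qed.

Lemma trade_arcs s u v : s \in slots ->
  ((u, v) \in all_arcs (turn_cycles s trade_on)) =
    ((u, v) \in all_arcs (turn_cycles s trade_off)) || star_rel s u v.
Proof.
move=> slot_s; apply: etrans (perm_mem (trade_perm slot_s) (u, v)) _.
rewrite mem_cat; congr (_ || _); apply: mem_rel_arcs.
by rewrite /star_rel /in_slot; lia.
Qed.

Lemma cell_rel_slots S u v :
  cell_rel S u v =
    cell_rel pred0 u v || has (fun s => S s && star_rel s u v) slots.
Proof.
case: u v => [a x] [b y].
have slotE c z : c < 3 -> z < 21 -> (c, (z - 11)./2) \in slots.
  move=> c3 z21; apply/allpairsP; exists (c, (z - 11)./2).
  by rewrite !mem_iota; split=> //=; lia.
apply/idP/orP.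
  rewrite /cell_rel /present /= => /and4P[/andP[a3 Sx] /andP[b3 Sy] nab xy].
  case: (ltnP x 11) Sx => [x11 _|x11] /=.
    case: (ltnP y 11) Sy => [y11 _|y11] /=.
      by left; rewrite a3 b3 nab.
    case/andP=> y21 Sy; right; apply/hasP; exists (b, (y - 11)./2).
      exact: slotE.
    by rewrite Sy /star_rel /in_slot /= nab a3 b3 y21 !eqxx; lia.
  case/andP=> x21 Sx'; right; apply/hasP; exists (a, (x - 11)./2).
    exact: slotE.
  by rewrite Sx' /star_rel /in_slot /= nab a3 b3 x21 !eqxx; lia.
case=> [|/hasP[[c l] _ /andP[Sl]]].
  by rewrite /cell_rel /present /= !andbF !orbF;
    case/and4P=> /andP[-> ->] /andP[-> ->] -> ->.
rewrite /star_rel /cell_rel /present /in_slot /=.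
case/and4P=> a3 b3 nab; rewrite a3 b3 nab /=.
by case/orP=> /andP[/and4P[z21 /eqP ac z11 /eqP zl] w10]; subst;
  rewrite Sl z21 !orbT /=; lia.
Qed.

Lemma mem_cell_cycles S a :
  (a \in all_arcs (cell_cycles S)) =
    (a \in all_arcs rigid_part) ||
    has (fun s => a \in all_arcs (turn_cycles s
                                    (if S s then trade_on else trade_off))) slots.
Proof.
rewrite (all_arcs_cat rigid_part) mem_cat; congr (_ || _).
exact: mem_all_arcs_flatten.
Qed.

(** Turning a trade on adds exactly the edges at its pair, so the edges for [S]
    are those of the cell without pairs and those at the pairs in [S]. *)
Lemma cell_arcs S u v :
  ((u, v) \in all_arcs (cell_cycles S)) = cell_rel S u v.
Proof.
apply: etrans (mem_cell_cycles S (u, v)) _; rewrite cell_rel_slots.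
rewrite -(etrans (esym (mem_cell_cycles pred0 (u, v))) (cell_arcs_empty u v)).
rewrite -orbA -has_predU.
congr (_ || _); apply: eq_in_has => s slot_s /=.
by case: (S s); rewrite ?orbF //= trade_arcs.
Qed.

(** Turning more trades on only adds edges, so it is enough that no edge is
    repeated when all pairs are present. *)
Lemma cell_uniq S : uniq (all_arcs (cell_cycles S)).
Proof.
have Ufull : uniq (all_arcs (cell_cycles predT)).
  have full_uniq := perm_uniq cell_perm_full.
  by have := uniq_rel_arcs (cell_rel predT); rewrite -full_uniq.
have le_count a : count_mem a (all_arcs (cell_cycles S)) <=
    count_mem a (all_arcs (cell_cycles predT)).
  have splitC S' : count_mem a (all_arcs (cell_cycles S')) =
      count_mem a (all_arcs rigid_part) +
      count_mem a (all_arcs (flatten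
        [seq turn_cycles s (if S' s then trade_on else trade_off) | s <- slots])).
    by rewrite (all_arcs_cat rigid_part) count_cat.
  apply: leq_trans (eq_leq (splitC S)) _.
  apply: leq_trans (eq_leq (esym (splitC predT))).
  rewrite leq_add2l; apply: count_all_arcs_flatten => s slot_s.
  case: (S s); first exact: leqnn.
  have onE := etrans (permP (trade_perm slot_s) (pred1 a)) (count_cat _ _ _).
  apply: leq_trans (eq_leq (esym onE)).
  exact: leq_addr.
apply: count_mem_uniq => a; rewrite -has_pred1 has_count.
have le1 : count_mem a (all_arcs (cell_cycles S)) <= 1.
  apply: leq_trans (le_count a) _.
  by rewrite (count_uniq_mem a Ufull); apply: leq_b1.
by move: (count_mem a (all_arcs (cell_cycles S))) le1 => [|[|n]].
Qed.

(** * Dealing the vertices of a part out to the rows *)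

(** A part of the large graph is numbered so that the old vertices come first,
    [R] being their number.  The first [q] of them are the singles; the others
    are grouped in consecutive pairs, pair [m] going to row m mod q as pair
    m / q of that row.  New vertices go to the rows in the same cyclic way. *)
Definition row_of (q R x : nat) : nat :=
  if x < R then if x < q then x else (x - q)./2 %% q else (x - R) %% q.

Definition pos_of (q R x : nat) : nat :=
  if x < R then if x < q then 10 else 11 + 2 * ((x - q)./2 %/ q) + odd (x - q)
  else (x - R) %/ q.

Definition value_at (q R i z : nat) : nat :=
  if z < 10 then R + (z * q + i)
  else if z == 10 then i else q + 2 * ((z - 11)./2 * q + i) + odd (z - 11).

Lemma value_atK q R x : 0 < q -> q <= R -> x < R + 10 * q ->
  value_at q R (row_of q R x) (pos_of q R x) = x.
Proof.
move=> q0 qR xN.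
rewrite /value_at /row_of /pos_of; case: (ltnP x R) => xR.
  case: (ltnP x q) => xq //.
  set m := (x - q)./2.
  have small d (b : bool) : [/\ 11 + 2 * d + b < 10 = false,
      11 + 2 * d + b == 10 = false & 11 + 2 * d + b - 11 = b + d.*2].
    by split; lia.
  have [-> -> ->] := small (m %/ q) (odd (x - q)).
  rewrite half_bit_double oddD odd_double addbF oddb -divn_eq.
  by rewrite /m mul2n -addnA [_ + odd _]addnC odd_double_half subnKC.
have -> : (x - R) %/ q < 10 by rewrite ltn_divLR //; lia.
by rewrite -divn_eq subnKC.
Qed.

Lemma pos_of_lt q R x : 0 < q -> R <= 11 * q -> x < R + 10 * q ->
  pos_of q R x < 21.
Proof.
move=> q0 Rq xN; rewrite /pos_of; case: (ltnP x R) => xR.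
  case: (ltnP x q) => xq //.
  have: (x - q)./2 %/ q < 5 by rewrite ltn_divLR //; lia.
  lia.
have : (x - R) %/ q < 10 by rewrite ltn_divLR //; lia.
lia.
Qed.

Lemma pos_of_new q R x : 0 < q -> x < R + 10 * q ->
  (pos_of q R x < 10) = (R <= x).
Proof.
move=> q0 xN; rewrite /pos_of; case: (ltnP x R) => xR.
  by case: ifP => // _; rewrite -addnA.
by rewrite ltn_divLR //; lia.
Qed.

Lemma row_of_lt q R x : 0 < q -> row_of q R x < q.
Proof.
move=> q0; rewrite /row_of; case: ifP => _; last exact: ltn_pmod.
by case: ifP => // _; apply: ltn_pmod.
Qed.

(** The parity hypothesis makes the pairs exhaust the old vertices: if the first
    vertex of a pair exists, then so does the second. *)
Lemma value_at_ok q R i z :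
  0 < q -> q <= R -> odd R = odd q -> i < q -> z < 21 ->
  (10 < z -> q + 2 * ((z - 11)./2 * q + i) < R) ->
  [/\ value_at q R i z < R + 10 * q, row_of q R (value_at q R i z) = i
    & pos_of q R (value_at q R i z) = z].
Proof.
move=> q0 qR oddR iq z21 zR; rewrite /value_at.
case: (ltnP z 10) => z10.
  have le_zq : z * q <= 9 * q by rewrite leq_mul2r; lia.
  rewrite /row_of /pos_of.
  have -> : R + (z * q + i) < R = false by lia.
  rewrite addKn modnMDl modn_small // divnMDl // divn_small // addn0.
  by split=> //; lia.
case: eqP => [->|z11].
  rewrite /row_of /pos_of iq (leq_trans iq qR); split=> //; lia.
have {}z11 : 10 < z by lia.
have {zR} := zR z11; set l := (z - 11)./2; set m := l * q + i => zR.
have [b zE] : exists b : bool, z = 11 + (b + l.*2).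
  by exists (odd (z - 11)); rewrite odd_double_half; lia.
have -> : odd (z - 11) = b.
  by rewrite zE addKn oddD odd_double addbF oddb.
have vE : q + 2 * m + b - q = b + m.*2 by lia.
have oddm : q + 2 * m + b < R.
  case: b {zE vE}; rewrite ?addn0 // addn1.
  rewrite ltn_neqAle zR andbT; apply/eqP => eqR; move: oddR.
  by rewrite -eqR mul2n /= oddD odd_double addbF; case: (odd q).
rewrite /row_of /pos_of oddm vE half_bit_double oddD odd_double addbF oddb.
have -> : q + 2 * m + b < q = false by lia.
rewrite /m modnMDl modn_small // divnMDl // divn_small //.
by split=> //; rewrite ?zE; lia.
Qed.

(** * Complete tripartite graphs *)

Definition value (r s t : nat) (v : tripartite_vertex r s t) : nat :=
  match v with inl (inl x) => x | inl (inr x) => x | inr x => x end.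

Definition part_size (r s t c : nat) : nat :=
  match c with 0 => r | 1 => s | _ => t end.

Lemma part_lt r s t (v : tripartite_vertex r s t) : part v < 3.
Proof. by case: v => [[]|]. Qed.

Lemma value_lt r s t (v : tripartite_vertex r s t) :
  value v < part_size r s t (part v).
Proof. by case: v => [[]|] x /=. Qed.

Lemma vertex_inj r s t (u v : tripartite_vertex r s t) :
  part u = part v -> value u = value v -> u = v.
Proof.
by case: u v => [[x|x]|x] [[y|y]|y] //= _ /val_inj->.
Qed.

Lemma vertexP r s t c x : c < 3 -> x < part_size r s t c ->
  exists2 v : tripartite_vertex r s t, part v = c & value v = x.
Proof.
case: c => [|[|[|c]]] // _ xR.
- by exists (inl (inl (Ordinal xR))).
- by exists (inl (inr (Ordinal xR))).
by exists (inr (Ordinal xR)).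
Qed.

Lemma complete_tripartite_sym r s t : symmetric (complete_tripartite r s t).
Proof. by move=> u v; rewrite /complete_tripartite eq_sym. Qed.

Lemma card_neighbors r s t (u : tripartite_vertex r s t) :
  #|[set v | complete_tripartite r s t u v]| =
    r + s + t - part_size r s t (part u).
Proof.
rewrite -sum1dep_card big_mkcond !big_sumType /complete_tripartite /=.
rewrite !big_const_ord !iter_addn_0.
by case: u => [[]|] x /=; lia.
Qed.

(** A vertex of the first part has degree s + t, one of the second r + t. *)
Lemma decomposable_parity r s t : 0 < r -> r <= s -> s <= t ->
  cycle_decomposable (complete_tripartite r s t) 5 ->
  odd s = odd r /\ odd t = odd r.
Proof.
move=> r0 rs st dec.
have deg u := even_degree u (@complete_tripartite_sym r s t) _ dec.
have irr : irreflexive (complete_tripartite r s t).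
  by move=> u; rewrite /complete_tripartite eqxx.
have [u u0 _] := @vertexP r s t 0 0 isT r0.
have [v v1 _] := @vertexP r s t 1 0 isT (leq_trans r0 rs).
have := deg irr v; have := deg irr u; rewrite !card_neighbors u0 v1 /=.
lia.
Qed.

(** The Latin square: the cell (i, j) uses the row [row_at q i j c] of part [c]. *)
Definition row_at (q i j c : nat) : nat :=
  match c with 0 => i | 1 => j | _ => (i + j) %% q end.

Lemma row_at_lt q i j c : i < q -> j < q -> row_at q i j c < q.
Proof. by case: c => [|[|c]] //= iq _; rewrite ltn_pmod //; lia. Qed.

Lemma modn_inj q i j k : j < q -> k < q ->
  (i + j) %% q = (i + k) %% q -> j = k.
Proof.
by move=> jq kq /eqP; rewrite eqn_modDl !modn_small // => /eqP.
Qed.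

Lemma row_at_inj q i j i' j' c c' : i < q -> j < q -> i' < q -> j' < q ->
  c < 3 -> c' < 3 -> c != c' ->
  row_at q i j c = row_at q i' j' c -> row_at q i j c' = row_at q i' j' c' ->
  i = i' /\ j = j'.
Proof.
move=> iq jq iq' jq'.
by case: c c' => [|[|[|c]]] [|[|[|c']]] //= _ _ _ E1 E2; split=> //; subst;
  first [exact: modn_inj E2 | exact: modn_inj E1
        | apply: (@modn_inj q j') => //; rewrite ![j' + _]addnC].
Qed.

Lemma row_at_surj q a b c c' : a < q -> b < q ->
  c < 3 -> c' < 3 -> c != c' ->
  exists i j : 'I_q, row_at q i j c = a /\ row_at q i j c' = b.
Proof.
move=> aq bq.
have sub x y : x < q -> y < q -> exists z : 'I_q, (x + z) %% q = y.
  move=> xq yq; have zq : (y + (q - x)) %% q < q by rewrite ltn_pmod; lia.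
  exists (Ordinal zq) => /=; rewrite modnDmr.
  have -> : x + (y + (q - x)) = y + q by lia.
  by rewrite modnDr modn_small.
pose i := Ordinal aq; pose j := Ordinal bq.
have [z az] := sub a b aq bq; have [w bw] := sub b a bq aq.
case: c c' => [|[|[|c]]] [|[|[|c']]] //= _ _ _.
- by exists i, j.
- by exists i, z.
- by exists j, i.
- by exists z, i; rewrite addnC.
- by exists j, w.
by exists w, j; rewrite addnC.
Qed.

(** * The enlarged graph *)

Local Notation big_vertex r s t n := (tripartite_vertex (r + n) (s + n) (t + n)).

Definition is_new r s t n (v : big_vertex r s t n) : bool :=
  part_size r s t (part v) <= value v.

Definition vrow r s t q (v : big_vertex r s t (10 * q)) : nat :=
  row_of q (part_size r s t (part v)) (value v).

Definition vpos r s t q (v : big_vertex r s t (10 * q)) : nat :=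
  pos_of q (part_size r s t (part v)) (value v).

Lemma big_value_lt r s t n (v : big_vertex r s t n) :
  value v < part_size r s t (part v) + n.
Proof. by have := value_lt v; case: v => [[]|]. Qed.

Lemma big_vertexP r s t n c x : c < 3 -> x < part_size r s t c + n ->
  exists2 v : big_vertex r s t n, part v = c & value v = x.
Proof. by move=> c3 xN; apply: vertexP => //; case: c c3 xN => [|[|[]]]. Qed.

Definition cell_edge r s t q i j : rel (big_vertex r s t (10 * q)) :=
  fun u v => [&& part u != part v, is_new u || is_new v,
    vrow u == row_at q i j (part u) & vrow v == row_at q i j (part v)].

(** Every row receives its single vertex, at most five pairs per row are needed,
    and no old vertex is left over. *)
Definition good_sizes r s t q := forall c,
  [/\ q <= part_size r s t c, part_size r s t c <= 11 * q
    & odd (part_size r s t c) = odd q].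

(** In the cell (i, j) exactly the pairs whose first vertex exists are present. *)
Lemma cell_decomposable r s t q i j : 0 < q -> i < q -> j < q ->
  good_sizes r s t q -> cycle_decomposable (@cell_edge r s t q i j) 5.
Proof.
move=> q0 iq jq good.
pose S (a : nat * nat) :=
  q + 2 * (a.2 * q + row_at q i j a.1) < part_size r s t a.1.
pose A (v : big_vertex r s t (10 * q)) := vrow v == row_at q i j (part v).
have atK (v : big_vertex r s t (10 * q)) : A v ->
    value_at q (part_size r s t (part v)) (row_at q i j (part v)) (vpos v)
      = value v.
  move=> /eqP <-; have [qR _ _] := good (part v).
  exact: value_atK (big_value_lt v).
have new_pos (v : big_vertex r s t (10 * q)) : (vpos v < 10) = is_new v.
  exact: pos_of_new (big_value_lt v).
have presentA (v : big_vertex r s t (10 * q)) :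
    A v -> present S (part v, vpos v).
  move=> Av; rewrite /present /= part_lt /=.
  have [qR Rq _] := good (part v).
  rewrite (pos_of_lt q0 Rq (big_value_lt v)) /=.
  case: (ltnP (vpos v) 11) => //= v11; rewrite /S /=.
  have : ~~ is_new v by rewrite -new_pos; lia.
  rewrite /is_new -ltnNge -(atK v Av) /value_at.
  have -> : vpos v < 10 = false by lia.
  have -> : vpos v == 10 = false by lia.
  by apply: leq_ltn_trans; apply: leq_addr.
apply: (@decomposable_preim _ (cell_cycles S) _ A (fun v => (part v, vpos v))).
- by [].
- exact: cell_cycles_ok.
- exact: cell_uniq.
- move=> u v Au Av [puv posuv]; apply: vertex_inj => //.
  by rewrite -(atK u Au) -(atK v Av) puv posuv.
- case=> c z y; rewrite cell_arcs => /and4P[/andP[/= c3 Sz] _ _ _].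
  have [qR Rq oddR] := good c.
  have rq := @row_at_lt q i j c iq jq.
  have z21 : z < 21 by lia.
  have Sz' : 10 < z ->
      q + 2 * ((z - 11)./2 * q + row_at q i j c) < part_size r s t c.
    by move=> z10; move: Sz; rewrite ltnNge z10 /= => /andP[_].
  have [valN rowv posv] := value_at_ok q0 qR oddR rq z21 Sz'.
  have [v pv vv] := big_vertexP c3 valN.
  by exists v; rewrite ?unfold_in /A /vrow /vpos pv vv ?rowv ?posv.
move=> u v; rewrite cell_arcs /cell_rel /= !new_pos /cell_edge.
rewrite !unfold_in -/(A u) -/(A v).
case Au : (A u); last by rewrite !andbF.
case Av : (A v); last by rewrite !andbF.
by rewrite !presentA //= !andbT.
Qed.

Lemma enlarge_decomposable r s t q : 0 < q -> good_sizes r s t q ->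
  cycle_decomposable (complete_tripartite r s t) 5 ->
  cycle_decomposable
    (complete_tripartite (r + 10 * q) (s + 10 * q) (t + 10 * q)) 5.
Proof.
move=> q0 good dec.
pose V := big_vertex r s t (10 * q).
pose e_old (u v : V) := [&& part u != part v, ~~ is_new u & ~~ is_new v].
pose e_new (u v : V) := (part u != part v) && (is_new u || is_new v).
apply: (@decomposable_union _ e_old e_new).
- by move=> u v; rewrite /e_new eq_sym orbC.
- by move=> u v; rewrite /e_old /e_new => /and3P[-> /negPf-> /negPf->].
- move=> u v; rewrite /complete_tripartite /e_old /e_new -andb_orr.
  by rewrite -negb_or orNb andbT.
- pose h (v : tripartite_vertex r s t) : V := match v with
    | inl (inl x) => inl (inl (lshift _ x))
    | inl (inr x) => inl (inr (lshift _ x))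
    | inr x => inr (lshift _ x) end.
  have part_h v : part (h v) = part v by case: v => [[]|].
  have value_h v : value (h v) = value v by case: v => [[]|].
  apply: (decomposable_inj (h := h)) dec.
  + move=> u v huv; apply: vertex_inj.
      by rewrite -part_h huv part_h.
    by rewrite -value_h huv value_h.
  + move=> u v; rewrite /e_old /complete_tripartite /is_new !part_h !value_h.
    by rewrite -!ltnNge !value_lt !andbT.
  have old_h (v : V) : ~~ is_new v -> v \in codom h.
    rewrite /is_new -ltnNge => /(vertexP (part_lt v))[w pw vw].
    by apply/codomP; exists w; apply: vertex_inj; rewrite ?part_h ?value_h.
  by move=> u v /and3P[_ /old_h-> /old_h->].
apply: (@decomposable_bigunion _ ('I_q * 'I_q)%type
  (fun ij => @cell_edge r s t q ij.1 ij.2)).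
- move=> ij u v; rewrite /cell_edge eq_sym orbC; congr [&& _, _ & _].
  exact: andbC.
- by move=> [i j]; apply: cell_decomposable.
- move=> [i j] [i' j'] u v /= /and4P[puv _ /eqP ru /eqP rv].
  move=> /and4P[_ _ /eqP ru' /eqP rv'].
  have [||/val_inj-> /val_inj->] // := @row_at_inj q i j i' j' (part u) (part v)
    (ltn_ord i) (ltn_ord j) (ltn_ord i') (ltn_ord j') (part_lt u) (part_lt v) puv.
    by rewrite -ru.
  by rewrite -rv.
move=> u v; apply/idP/existsP => [/andP[puv uv_new]|[ij]]; last first.
  by rewrite /e_new => /and4P[-> -> _ _].
have [i [j [ru rv]]] := row_at_surj (row_of_lt _ _ q0 : vrow u < q)
  (row_of_lt _ _ q0 : vrow v < q) (part_lt u) (part_lt v) puv.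
by exists (i, j); rewrite /cell_edge /= puv uv_new ru rv !eqxx.
Qed.

Theorem theorem4p2 (r s t p : nat)
    (r_gt0 : 0 < r) (le_rs : r <= s) (le_st : s <= t)
    (dec_rst : cycle_decomposable (complete_tripartite r s t) 5)
    (p_gt0 : 0 < p) (p_dvd5 : 5 %| p) (p_mod2 : p = r %[mod 2])
    (p_ge : t <= 2 * p) (p_le : p <= 3 * r) :
  cycle_decomposable
    (complete_tripartite (r + 2 * p) (s + 2 * p) (t + 2 * p)) 5.
Proof.
have [odd_s odd_t] := decomposable_parity r_gt0 le_rs le_st dec_rst.
case/dvdnP: p_dvd5 => q pE.
have -> : 2 * p = 10 * q by lia.
have odd_r : odd r = odd q.
  by move: p_mod2; rewrite !modn2 pE oddM andbT; do 2!case: odd.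
apply: enlarge_decomposable => //; first by lia.
by case=> [|[|c]]; split=> /=; rewrite ?odd_s ?odd_t //; lia.
Qed.
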